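(* Let $G,H<\mathrm{Homeo}^+(\mathbf{R})$ be group actions such that: (1) Both actions are minimal. (2) Both $G$ and $H$ contain non-identity elements with supports contained in compact intervals. (3) There exist $g\in G$, $h\in H$ such that $g,h$ have trivial germs at $-\infty$ and there is an interval $(r,\infty)$ on which both $g,h$ are increasing. (4) $G\cong H$. Then for each isomorphism $\nu:G\to H$ there is a homeomorphism $\phi:\mathbf{R}\to\mathbf{R}$ such that $\nu(f)=\phi^{-1}f\phi$ for each $f\in G$.
   Context: $\mathrm{Homeo}^+(\mathbf{R})$ is the group of orientation preserving homeomorphisms of $\mathbf{R}$. Actions are right actions, $x\mapsto x\cdot g$, and $x\cdot(fg)=(x\cdot f)\cdot g$. A group action $G<\mathrm{Homeo}^+(\mathbf{R})$ means a subgroup of $\mathrm{Homeo}^+(\mathbf{R})$. An action is minimal if all its orbits are dense in $\mathbf{R}$. The support of $g$ is $\{x\in\mathbf{R}\mid x\cdot g\neq x\}$. An element has trivial germ at $-\infty$ if it fixes each point of $(-\infty,s)$ for some $s\in\mathbf{R}$. An element $g$ is said to be increasing on an interval $J$ if $x<x\cdot g$ for each $x\in J$. *)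

(* Defs.v *)
From HB Require Import structures.
From mathcomp Require Import all_boot all_order all_algebra.
From mathcomp Require Import all_classical all_reals all_analysis.

Set Implicit Arguments.
Unset Strict Implicit.
Unset Printing Implicit Defensive.

Import Order.TTheory GRing.Theory Num.Theory.
Import numFieldNormedType.Exports.

Local Open Scope classical_set_scope.
Local Open Scope ring_scope.

(** The image [x . f] of the right-action convention is written [f x]. *)
Record homeo (T : topologicalType) := Homeo {
  homeo_fun :> T -> T;
  homeo_inv : T -> T;
  homeo_funK : cancel homeo_fun homeo_inv;
  homeo_invK : cancel homeo_inv homeo_fun;
  homeo_cts : continuous homeo_fun;
  homeo_inv_cts : continuous homeo_inv }.

Section HomeoGroup.
Variable T : topologicalType.
Implicit Types f g h : homeo T.

Lemma homeo_ext f g : f =1 g -> f = g.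
Proof.
case: f g => [f f' fK f'K fc f'c] [g g' gK g'K gc g'c] /= fg.
have {fg}E : f = g by apply/funext.
subst g.
have E' : f' = g' by apply/funext => x; rewrite -[in LHS](g'K x) fK.
subst g'.
by congr Homeo; exact: Prop_irrelevance.
Qed.

Definition homeo_one : homeo T.
Proof. by apply: (@Homeo T id id) => // x; exact: cvg_id. Defined.

Definition homeo_mul f g : homeo T.
Proof.
apply: (@Homeo T (g \o f) (homeo_inv f \o homeo_inv g)).
- by apply: can_comp; exact: homeo_funK.
- by apply: can_comp; exact: homeo_invK.
- by move=> x; apply: continuous_comp; exact: homeo_cts.
- by move=> x; apply: continuous_comp; exact: homeo_inv_cts.
Defined.

Definition homeo_invg f : homeo T :=
  Homeo (@homeo_invK T f) (@homeo_funK T f)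
        (@homeo_inv_cts T f) (@homeo_cts T f).

Lemma homeo_mulA : associative homeo_mul.
Proof. by move=> f g h; exact: homeo_ext. Qed.

Lemma homeo_mul1 : left_id homeo_one homeo_mul.
Proof. by move=> f; exact: homeo_ext. Qed.

Lemma homeo_mulr1 : right_id homeo_one homeo_mul.
Proof. by move=> f; exact: homeo_ext. Qed.

Lemma homeo_mulV : left_inverse homeo_one homeo_invg homeo_mul.
Proof. by move=> f; apply: homeo_ext => x; exact: homeo_invK. Qed.

Lemma homeo_mulrV : right_inverse homeo_one homeo_invg homeo_mul.
Proof. by move=> f; apply: homeo_ext => x; exact: homeo_funK. Qed.

End HomeoGroup.

HB.instance Definition _ (T : topologicalType) := gen_eqMixin (homeo T).
HB.instance Definition _ (T : topologicalType) := gen_choiceMixin (homeo T).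
HB.instance Definition _ (T : topologicalType) :=
  isGroup.Build (homeo T) (@homeo_mulA T) (@homeo_mul1 T) (@homeo_mulr1 T)
    (@homeo_mulV T) (@homeo_mulrV T).

Lemma homeo_mulE (T : topologicalType) (f g : homeo T) (x : T) :
  (f * g)%g x = g (f x).
Proof. by []. Qed.

Lemma homeo_oneE (T : topologicalType) (x : T) : (1%g : homeo T) x = x.
Proof. by []. Qed.

Lemma homeo_invE (T : topologicalType) (f : homeo T) (x : T) :
  (f^-1)%g x = homeo_inv f x.
Proof. by []. Qed.

Definition is_subgroup (U : groupType) (G : set U) : Prop :=
  group_closed [in G].

(** A map [G -> H] is represented by a total function on the ambient group,
    whose values outside [G] are irrelevant. *)
Definition is_isomorphism (U V : groupType) (G : set U) (H : set V)
    (nu : U -> V) : Prop :=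
  set_bij G H nu /\ {in G &, {morph nu : f g / (f * g)%g}}.

Definition isomorphic (U V : groupType) (G : set U) (H : set V) : Prop :=
  exists nu : U -> V, is_isomorphism G H nu.

Definition Homeo_plus (R : realType) : set (homeo R) :=
  [set f | {homo f : x y / x < y}].
Arguments Homeo_plus : clear implicits.

Definition group_action (R : realType) (G : set (homeo R)) : Prop :=
  is_subgroup G /\ G `<=` Homeo_plus R.

Definition homeo_orbit (T : topologicalType) (G : set (homeo T)) (x : T) : set T :=
  [set f x | f in G].

Definition minimal_action (T : topologicalType) (G : set (homeo T)) : Prop :=
  forall x : T, dense (homeo_orbit G x).

Definition hsupport (T : topologicalType) (f : homeo T) : set T :=
  [set x | f x <> x].

Definition compactly_supported (R : realType) (f : homeo R) : Prop :=
  exists a b : R, hsupport f `<=` `[a, b].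

Definition trivial_germ_ninfty (R : realType) (f : homeo R) : Prop :=
  exists s : R, forall x : R, x \in `]-oo, s[ -> f x = x.

Definition increasing_on (R : realType) (J : set R) (f : homeo R) : Prop :=
  forall x : R, J x -> x < f x.

(* Main.v *)
Require Import Defs.
From mathcomp Require Import all_boot all_order all_algebra.
From mathcomp Require Import all_classical all_reals all_analysis.
Import numFieldNormedType.Exports.

(** The conjugating homeomorphism is read off from the group structure, through
    the fixed points of commuting elements.

    For [x] in the line, let [G_x] be the subgroup of the [f] in [G] that fix
    every point up to [x], and let [A_x] ([right_fixed x]) be the set of points
    fixed by all of [nu G_x].  The family is canonical: [A_x] grows with [x] and
    [A_(f x)] is the image of [A_x] under [nu f].  So if every [A_x] is nonempty
    and bounded above, [phi x = sup A_x] is monotone and satisfies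
    [phi (f x) = nu f (phi x)]; if it is bounded below, [inf A_x] does the same
    with reversed order.  Minimality then makes [phi] a homeomorphism: its image
    contains an orbit of [H], hence is dense, so [phi] has no jumps, and an
    interval of constancy would spread by minimality of [G] to the whole line.
    The equation [phi (f x) = nu f (phi x)] is the desired conjugacy.

    It remains to see that [A_x] is nonempty and bounded on some side.

    Nonempty: some nontrivial [c] in [G] has compact support together with
    [nu c] ([exists_common_compact]); it is a commutator of a compactly supported
    element of [G] with the preimage of a compactly supported element of [H].
    If the support of [c] lies below [b], then [G_b] commutes with [c], so
    [nu G_b] preserves the support of [nu c] and fixes its supremum
    ([right_fixed_support_top]).

    Bounded: this is where the element [g] with trivial germ at [-oo], increasing
    near [+oo], enters ([right_fixed_bounded]).  It lies in some [G_s], so were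
    [A_s] unbounded in both directions, [nu g] would have fixed points on both
    sides of the support of [nu c].  Conjugating [c] by the powers of [g] pushes
    it away to [+oo] in the first action, while in the second the top of the
    support stays in a bounded region; in the limit one gets a point fixed by the image of
    every compactly supported element of [G], which minimality of [H]
    excludes. *)

Import Order.TTheory GRing.Theory Num.Theory.

Local Open Scope classical_set_scope.
Local Open Scope ring_scope.

(** * Monotone maps and iteration on the line *)

Section OrderTopology.
Set Implicit Arguments.
Unset Strict Implicit.
Context {R : realType}.
Implicit Types (f g u : homeo R) (A : set R) (phi psi : R -> R) (x y z : R).

Lemma Homeo_plus_lt f x y : Homeo_plus R f -> (f x < f y) = (x < y).
Proof.
move=> fP; apply/idP/idP => [|/fP//]; case: (ltgtP x y) => // [/fP|->].
  by move=> /lt_trans /[apply]; rewrite ltxx.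
by rewrite ltxx.
Qed.

Lemma Homeo_plus_le f x y : Homeo_plus R f -> (f x <= f y) = (x <= y).
Proof. by move=> fP; rewrite !leNgt Homeo_plus_lt. Qed.

Lemma Homeo_plus_invl f x y : Homeo_plus R f -> (homeo_inv f x <= y) = (x <= f y).
Proof. by move=> fP; rewrite -(Homeo_plus_le _ _ fP) homeo_invK. Qed.

Lemma Homeo_plus_invr f x y : Homeo_plus R f -> (x <= homeo_inv f y) = (f x <= y).
Proof. by move=> fP; rewrite -(Homeo_plus_le _ _ fP) homeo_invK. Qed.

Lemma increasing_bij_continuous phi psi :
  {mono phi : x y / x < y} -> cancel psi phi -> continuous phi.
Proof.
move=> phi_lt psiK x; apply/cvgrPdist_lt => e e0.
have xI : x \in `](psi (phi x - e)), (psi (phi x + e))[.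
  by rewrite in_itv /= -(phi_lt (psi _)) -(phi_lt x (psi _)) !psiK ltrBlDr ltrDl e0.
near=> y.
have : y \in `](psi (phi x - e)), (psi (phi x + e))[.
  by near: y; exact: near_in_itvoo.
by rewrite in_itv /= -(phi_lt (psi _)) -(phi_lt y (psi _)) !psiK distrC ltr_distl.
Unshelve. all: by end_near. Qed.

Lemma increasing_bij_homeo phi psi :
  {mono phi : x y / x < y} -> cancel psi phi -> exists u : homeo R, u =1 phi.
Proof.
move=> phi_lt psiK.
have phi_inj : injective phi.
  move=> x y e; apply/eqP; case: (ltgtP x y) => //;
  by rewrite -phi_lt e ltxx.
have phiK : cancel phi psi by move=> x; apply: phi_inj; rewrite psiK.
have psi_lt : {mono psi : x y / x < y} by move=> x y; rewrite -(phi_lt (psi x)) !psiK.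
by exists (Homeo phiK psiK (increasing_bij_continuous phi_lt psiK)
  (increasing_bij_continuous psi_lt phiK)).
Qed.

Lemma dense_itv A x y : dense A -> x < y -> exists2 z, A z & x < z < y.
Proof.
move=> /(_ `]x, y[%classic) dA xy; case: dA.
- by exists ((x + y) / 2); rewrite /= in_itv /= !(midf_lt xy).
- exact: interval_open.
- by move=> z []; rewrite /= in_itv /= => ? ?; exists z.
Qed.

(** Density of the image fills the jumps of [phi]: a value [y] is attained at
    the supremum of [{t | phi t <= y}], because any gap between [y] and the
    value there would contain some [phi t] on the wrong side. *)
Lemma increasing_dense_homeo phi : {homo phi : x y / x < y} ->
  (forall x y, x < y -> exists t, x < phi t < y) -> exists u : homeo R, u =1 phi.
Proof.
move=> phi_homo phi_dense.
have phi_lt : {mono phi : x y / x < y}.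
  move=> x y; apply/idP/idP => [|/phi_homo//]; case: (ltgtP x y) => // [/phi_homo|->].
    by move=> /lt_trans /[apply]; rewrite ltxx.
  by rewrite ltxx.
suff surj y : exists x, phi x = y.
  have [psi psiK] := choice surj; exact: (increasing_bij_homeo phi_lt psiK).
have y1 : y - 1 < y by rewrite ltrBlDr ltrDl.
have y2 : y < y + 1 by rewrite ltrDl.
have [t1 /andP[_ t1y]] := phi_dense _ _ y1.
have [t2 /andP[yt2 _]] := phi_dense _ _ y2.
pose S := [set t | phi t <= y].
have S0 : S !=set0 by exists t1; apply: ltW.
have ubS t : y < phi t -> ubound S t.
  by move=> yt s /= sy; rewrite ltW // -phi_lt (le_lt_trans sy).
have bS : has_ubound S by exists t2; exact: ubS.
exists (sup S); apply/eqP; case: ltgtP => //.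
- move=> /phi_dense[t /andP[+ ty]].
  by rewrite phi_lt ltNge (ub_le_sup bS) //=; exact: ltW.
- move=> /phi_dense[t /andP[yt]].
  by rewrite phi_lt ltNge (ge_sup S0) //; exact: ubS.
Qed.

Lemma sup_homeo f A : Homeo_plus R f -> A !=set0 -> has_ubound A ->
  sup (f @` A) = f (sup A).
Proof.
move=> fP [a Aa] bA; apply/eqP; rewrite eq_le; apply/andP; split.
  apply: ge_sup; first by exists (f a), a.
  by move=> _ [x Ax <-]; rewrite Homeo_plus_le //; exact: ub_le_sup.
rewrite -Homeo_plus_invr //; apply: ge_sup; first by exists a.
move=> x Ax; rewrite Homeo_plus_invr //; apply: ub_le_sup; last by exists x.
case: bA => b bA; exists (f b) => _ [z Az <-].
by rewrite Homeo_plus_le //; exact: bA.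
Qed.

Lemma inf_homeo f A : Homeo_plus R f -> A !=set0 -> has_lbound A ->
  inf (f @` A) = f (inf A).
Proof.
move=> fP [a Aa] bA; apply/eqP; rewrite eq_le; apply/andP; split; last first.
  apply: lb_le_inf; first by exists (f a), a.
  by move=> _ [x Ax <-]; rewrite Homeo_plus_le //; exact: ge_inf.
rewrite -Homeo_plus_invl //; apply: lb_le_inf; first by exists a.
move=> x Ax; rewrite Homeo_plus_invl //; apply: ge_inf; last by exists x.
case: bA => b bA; exists (f b) => _ [z Az <-].
by rewrite Homeo_plus_le //; exact: bA.
Qed.

Lemma cvgn_fixed f (u : nat -> R) l :
  u @ \oo --> l -> (\forall n \near \oo, f (u n) = u n) -> f l = l.
Proof.
move=> ul fix_u.
have fl : (fun n => f (u n)) @ \oo --> f l by exact: cvg_comp ul (@homeo_cts _ f l).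
apply: (cvg_unique _ fl); first exact: Rhausdorff.
by apply: cvg_trans ul; apply: near_eq_cvg; near=> n; symmetry; near: n.
Unshelve. all: by end_near. Qed.

Lemma cvgn_iter_fixed f x l : (fun n => iter n f x) @ \oo --> l -> f l = l.
Proof.
move=> ul.
have fl : (fun n => iter n.+1 f x) @ \oo --> f l.
  exact: cvg_comp ul (@homeo_cts _ f l).
rewrite -cvg_shiftS in ul.
by apply: (cvg_unique _ fl ul); exact: Rhausdorff.
Qed.

(** The fixed points [x] and [z] trap the orbit of [y], which is monotone since
    [f] preserves the order. *)
Lemma iter_bounded_cvgn f x y z : Homeo_plus R f ->
  f x = x -> f z = z -> x <= y <= z -> cvgn (fun n => iter n f y).
Proof.
move=> fP fx fz /andP[xy yz].
have /all_and2[x_iter iter_z] n : x <= iter n f y /\ iter n f y <= z.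
  elim: n => //= n [IH1 IH2].
  by rewrite -{1}fx -fz !Homeo_plus_le.
case: (leP y (f y)) => [yfy|/ltW fyy].
- apply: nondecreasing_is_cvgn; last by exists z => _ [n _ <-].
  apply/nondecreasing_seqP; elim=> //= n IHn; by rewrite Homeo_plus_le.
- apply: nonincreasing_is_cvgn; last by exists x => _ [n _ <-].
  apply/nonincreasing_seqP; elim=> //= n IHn; by rewrite Homeo_plus_le.
Qed.

(** A bounded orbit would converge to a fixed point of [f] above [r]. *)
Lemma iter_increasing_unbounded f r x : Homeo_plus R f ->
  increasing_on `]r, +oo[ f -> r < x ->
  forall b, \forall n \near \oo, b <= iter n f x.
Proof.
move=> fP f_inc rx b.
have f_gt y : r < y -> y < f y by move=> ry; apply: f_inc; rewrite /= in_itv /= ry.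
have r_iter n : r < iter n f x.
  by elim: n => //= n IHn; exact: lt_trans (f_gt _ IHn).
have nd : nondecreasing_seq (fun n => iter n f x).
  by apply/nondecreasing_seqP => n; exact/ltW/f_gt.
suff [N bN] : exists N, b <= iter N f x.
  by exists N => // n /= Nn; apply: le_trans bN _; exact: nd.
apply: contrapT => /forallNP nb.
have ub : has_ubound (range (fun n => iter n f x)).
  by exists b => _ [n _ <-]; rewrite leNgt; apply/negP => /ltW /nb.
have cu := nondecreasing_is_cvgn nd ub.
have := f_gt _ (lt_le_trans rx (nondecreasing_cvgn_le nd cu 0)).
by rewrite (cvgn_iter_fixed cu) ltxx.
Qed.

End OrderTopology.

(** * Subgroups and supports *)

Section Subgroups.
Set Implicit Arguments.
Unset Strict Implicit.
Context {U : groupType} (G : set U).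
Hypothesis subG : is_subgroup G.
Implicit Types f g u : U.

Lemma subgroup1 : G 1%g.
Proof. by have [+ _] := subG; rewrite inE. Qed.

Lemma subgroupV f : G f -> G (f^-1)%g.
Proof. by move=> Gf; have /(_ f) := group_closedV subG; rewrite !inE; apply. Qed.

Lemma subgroupM f g : G f -> G g -> G (f * g)%g.
Proof. by move=> Gf Gg; have /(_ f g) := group_closedM subG; rewrite !inE; apply. Qed.

Lemma subgroupJ f u : G f -> G u -> G (u^-1 * f * u)%g.
Proof. by move=> Gf Gu; do 2?apply: subgroupM => //; exact: subgroupV. Qed.

End Subgroups.

Lemma conj_neq1 (U : groupType) (f u : U) :
  f <> 1%g -> (u^-1 * f * u)%g <> 1%g.
Proof.
move=> f1 e; apply: f1; apply: (monoid.mulIg u); apply: (monoid.mulgI (u^-1)%g).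
by rewrite monoid.mulgA e monoid.mul1g monoid.mulVg.
Qed.

Section Supports.
Set Implicit Arguments.
Unset Strict Implicit.
Context {R : realType}.
Implicit Types (f g u c : homeo R) (G : set (homeo R)) (x y z : R).

Lemma homeo_conjE f u y : (u^-1 * f * u)%g (u y) = u (f y).
Proof. by rewrite !homeo_mulE homeo_invE homeo_funK. Qed.

Lemma hsupport_conj f u : hsupport (u^-1 * f * u)%g = u @` hsupport f.
Proof.
apply/seteqP; split=> [y|_ [y fy <-]]; rewrite /hsupport /mkset.
  rewrite -[y](homeo_invK u) homeo_conjE => fy.
  by exists (homeo_inv u y) => // e; apply: fy; rewrite e.
by rewrite homeo_conjE => /(can_inj (homeo_funK u)).
Qed.

Lemma hsupportV f : hsupport (f^-1)%g = hsupport f.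
Proof.
apply/seteqP; split=> y; rewrite /hsupport /mkset homeo_invE => fy e; apply: fy.
  by rewrite -{1}e homeo_funK.
by rewrite -{1}e homeo_invK.
Qed.

Lemma hsupportM f g : hsupport (f * g)%g `<=` hsupport f `|` hsupport g.
Proof.
move=> y; rewrite /hsupport /mkset homeo_mulE => fgy.
by have [fy|] := pselect (f y = y); [right; rewrite -{1}fy|left].
Qed.

Lemma hsupport_nonempty f : f <> 1%g -> hsupport f !=set0.
Proof.
move=> f1; apply: contrapT => /forallNP f_id; apply: f1; apply: homeo_ext => y.
by rewrite homeo_oneE; apply: contrapT; exact: f_id.
Qed.

Lemma compactly_supportedV f :
  compactly_supported f -> compactly_supported (f^-1)%g.
Proof. by rewrite /compactly_supported hsupportV. Qed.

Lemma compactly_supportedM f g : compactly_supported f ->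
  compactly_supported g -> compactly_supported (f * g)%g.
Proof.
move=> [a [b fab]] [c [d gcd]]; exists (Num.min a c), (Num.max b d).
move=> y /hsupportM[/fab|/gcd] /=; rewrite !in_itv /= => /andP[ay yb].
  by rewrite ge_min le_max ay yb.
by rewrite ge_min le_max ay yb !orbT.
Qed.

Lemma compactly_supportedJ f u : Homeo_plus R u ->
  compactly_supported f -> compactly_supported (u^-1 * f * u)%g.
Proof.
move=> uP [a [b fab]]; exists (u a), (u b) => y.
rewrite hsupport_conj => -[x /fab + <-].
by rewrite /= !in_itv /= !Homeo_plus_le.
Qed.

Lemma compactly_supported_ubound f :
  compactly_supported f -> has_ubound (hsupport f).
Proof.
move=> [a [b fab]]; exists b => y /fab.
by rewrite /= in_itv /= => /andP[].
Qed.

Lemma compactly_supported_fix_left f : compactly_supported f ->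
  exists a, forall z, z <= a -> f z = z.
Proof.
move=> [a [b fab]]; exists (a - 1) => z za; apply: contrapT => /fab.
rewrite /= in_itv /= => /andP[az _].
by have := le_trans az za; rewrite lerBrDr gerDl ler10.
Qed.

Lemma compactly_supported_fix_right f : compactly_supported f ->
  exists b, forall z, b <= z -> f z = z.
Proof.
move=> [a [b fab]]; exists (b + 1) => z bz; apply: contrapT => /fab.
rewrite /= in_itv /= => /andP[_ zb].
by have := le_trans bz zb; rewrite gerDl ler10.
Qed.

Lemma conj_fix_left f u a : Homeo_plus R u -> (forall z, z <= a -> f z = z) ->
  forall z, z <= u a -> (u^-1 * f * u)%g z = z.
Proof.
move=> uP f_id z; rewrite -(homeo_invK u z) Homeo_plus_le // => za.
by rewrite homeo_conjE f_id.
Qed.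

(** A point attached to [f] by a recipe that conjugation respects; this is how
    commutation relations produce fixed points. *)
Definition support_top f : R := sup (hsupport f).

Lemma support_top_conj f u : Homeo_plus R u -> f <> 1%g ->
  compactly_supported f -> support_top (u^-1 * f * u)%g = u (support_top f).
Proof.
move=> uP f1 cf; rewrite /support_top hsupport_conj sup_homeo //.
  exact: hsupport_nonempty.
exact: compactly_supported_ubound.
Qed.

Lemma commute_fix_support_top f u : Homeo_plus R u -> f <> 1%g ->
  compactly_supported f -> (f * u = u * f)%g ->
  u (support_top f) = support_top f.
Proof.
move=> uP f1 cf fu; rewrite -support_top_conj //.
by rewrite -monoid.mulgA fu monoid.mulKg.
Qed.

Lemma separated_supports_commute f c b : Homeo_plus R f -> Homeo_plus R c ->
  (forall x, x <= b -> f x = x) -> (forall x, b <= x -> c x = x) ->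
  (c * f = f * c)%g.
Proof.
move=> fP cP f_id c_id; apply: homeo_ext => x; rewrite !homeo_mulE.
have [xb|/ltW bx] := leP x b.
  by rewrite (f_id x) // f_id // -(c_id b) // Homeo_plus_le.
by rewrite (c_id x) // c_id // -(f_id b) // Homeo_plus_le.
Qed.

(** The support of [f] is open, so it meets the dense orbit unless it is
    empty. *)
Lemma dense_orbit_fix G f x : dense (homeo_orbit G x) ->
  (forall u, G u -> f (u x) = u x) -> f = 1%g.
Proof.
move=> dG fix_orbit; apply: contrapT => /hsupport_nonempty f0.
have [|y [fy [u Gu uy]]] := dG _ f0; last by case: fy; rewrite -uy fix_orbit.
have -> : hsupport f = (fun y => f y - y) @^-1` [set z | z != 0].
  by apply/seteqP; split=> y /=; rewrite subr_eq0 => /eqP.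
apply: open_comp; last exact: open_neq.
by move=> y _; apply: cvgB; [exact: homeo_cts|exact: cvg_id].
Qed.

Lemma minimal_orbit_lt G x y z : minimal_action G -> y < z ->
  exists2 f, G f & y < f x < z.
Proof.
by move=> /(_ x) dG /(dense_itv dG)[_ [f Gf <-] ?]; exists f.
Qed.

Lemma minimal_orbit_gt G x y : minimal_action G -> exists2 f, G f & y < f x.
Proof.
move=> /minimal_orbit_lt mG; have [|f Gf /andP[yf _]] := mG x y (y + 1).
  by rewrite ltrDl.
by exists f.
Qed.

End Supports.

(** * Reconstruction of the action *)

Section Reconstruction.
Set Implicit Arguments.
Unset Strict Implicit.
Context {R : realType} {G H : set (homeo R)} {nu : homeo R -> homeo R}.
Hypotheses (actG : group_action G) (actH : group_action H).
Hypotheses (minG : minimal_action G) (minH : minimal_action H).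
Hypothesis nu_iso : is_isomorphism G H nu.
Implicit Types (c d f g h u : homeo R) (phi : R -> R) (x y z : R).

Let subG : is_subgroup G := proj1 actG.
Let subH : is_subgroup H := proj1 actH.

Let GP f : G f -> Homeo_plus R f. Proof. exact: (proj2 actG). Qed.

Let nuG f : G f -> H (nu f).
Proof. by have [[nu_fun _ _] _] := nu_iso; exact: nu_fun. Qed.

Let nuP f : G f -> Homeo_plus R (nu f).
Proof. by move=> /nuG; exact: (proj2 actH). Qed.

Let nu_surj h : H h -> exists2 f, G f & nu f = h.
Proof. by have [[_ _ nu_surj] _] := nu_iso; exact: nu_surj. Qed.

Let nuM f g : G f -> G g -> nu (f * g)%g = (nu f * nu g)%g.
Proof. by move=> Gf Gg; have [_ ->] := nu_iso; rewrite ?inE. Qed.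

Let nu1 : nu 1%g = 1%g.
Proof.
have G1 := subgroup1 subG.
by apply: (monoid.mulgI (nu 1%g)); rewrite -nuM // !monoid.mulg1.
Qed.

Let nuV f : G f -> nu (f^-1)%g = ((nu f)^-1)%g.
Proof.
move=> Gf; apply: (monoid.mulgI (nu f)).
by rewrite -nuM ?monoid.mulgV ?nu1 //; exact: subgroupV.
Qed.

Let nuJ f u : G f -> G u -> nu (u^-1 * f * u)%g = ((nu u)^-1 * nu f * nu u)%g.
Proof.
move=> Gf Gu; have GuV := subgroupV subG Gu.
by rewrite !nuM ?nuV //; exact: subgroupM.
Qed.

Let nu_neq1 f : G f -> f <> 1%g -> nu f <> 1%g.
Proof.
move=> Gf f1; rewrite -nu1 => e; apply: f1.
have [[_ nu_inj _] _] := nu_iso.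
by apply: nu_inj => //; rewrite ?inE //; exact: subgroup1.
Qed.

Lemma equivariant_range_dense phi :
  (forall f x, G f -> phi (f x) = nu f (phi x)) ->
  forall x y, x < y -> exists t, x < phi t < y.
Proof.
move=> phi_eq x y /(minimal_orbit_lt (phi 0) minH)[_ /nu_surj[f Gf <-] xy].
by exists (f 0); rewrite phi_eq.
Qed.

(** If [phi] is constant on [[a, b]], then so it is near every [x], since some
    [f] in [G] carries [x] into the interior of [[a, b]] and [phi x] is
    determined by [phi (f x)].  A locally constant function on the line is
    constant, and its value would be a global fixed point of [H].  Requiring
    order-convex fibers covers increasing and decreasing maps at once. *)
Lemma equivariant_convex_fibers_inj phi :
  (forall f x, G f -> phi (f x) = nu f (phi x)) ->
  (forall x y z, x <= y <= z -> phi x = phi z -> phi y = phi x) ->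
  injective phi.
Proof.
move=> phi_eq phi_fib.
suff flat a b : a < b -> phi a <> phi b.
  by move=> a b phiab; apply/eqP; case: (ltgtP a b) => // /flat[].
move=> ab phiab.
have phi_near x : exists v, \near x, v = phi x.
  have [f Gf /andP[afx fxb]] := minimal_orbit_lt x minG ab.
  exists (homeo_inv (nu f) (phi a)).
  have fI : \forall y \near x, f y \in `]a, b[.
    have fxI : f x \in `]a, b[ by rewrite in_itv /= afx.
    exact: (@homeo_cts _ f x _ (near_in_itvoo fxI)).
  near=> y; have : f y \in `]a, b[ by near: y.
  rewrite in_itv /= => /andP[/ltW afy /ltW fyb].
  by rewrite -(phi_fib _ (f y) b) ?afy // phi_eq // homeo_funK.
have phi_cst x y : phi x = phi y.
  apply: is_derive_0_is_cst => {}x; have [v phi_v] := phi_near x.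
  exact: near_eq_is_derive phi_v (is_derive_cst _ _ _).
have [_ /nu_surj[f Gf <-]] := minimal_orbit_gt (phi a) (phi a) minH.
by rewrite -phi_eq // (phi_cst _ a) ltxx.
Unshelve. all: by end_near. Qed.

Lemma compactly_supportedJ_iso c u : G c -> G u ->
  compactly_supported (nu c) -> compactly_supported (nu (u^-1 * c * u)%g).
Proof. by move=> Gc Gu; rewrite nuJ //; apply: compactly_supportedJ; exact: nuP. Qed.

(** Let [nu k = h], and let [v] run over the conjugates of [f].  A commutator of
    order-preserving maps is compactly supported as soon as one of them is, so
    the commutator of [k] and [v] is compactly supported because of [v], and
    its image because of [nu k].  If [k] commuted with every conjugate of [f],
    it would fix the tops of all their supports, which form an orbit of [G]; by
    minimality [k] would be trivial. *)
Lemma exists_common_compact f h :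
  G f -> f <> 1%g -> compactly_supported f ->
  H h -> h <> 1%g -> compactly_supported h ->
  exists c, [/\ G c, c <> 1%g, compactly_supported c & compactly_supported (nu c)].
Proof.
move=> Gf f1 cf /nu_surj[k Gk <-] k1 ck.
have [u [Gu ku]] : exists u, G u /\ ((u^-1 * f * u) * k <> k * (u^-1 * f * u))%g.
  apply: contrapT => /forallNP nu_comm; apply: k1.
  suff -> : k = 1%g by exact: nu1.
  apply: (dense_orbit_fix (minG (support_top f))) => u Gu.
  rewrite -(support_top_conj (GP Gu) f1 cf).
  apply: commute_fix_support_top (GP Gk) _ _ _; last 1 first.
  - by apply: contrapT => ?; exact: (nu_comm u).
  - exact: conj_neq1.
  - by apply: compactly_supportedJ => //; exact: GP.
set v := (u^-1 * f * u)%g in ku.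
have Gv : G v by exact: subgroupJ.
have cv : compactly_supported v by apply: compactly_supportedJ => //; exact: GP.
(* As an abstract element, [v] is not unfolded by the rules for [nu]. *)
clearbody v; have GkV := subgroupV subG Gk; have GvV := subgroupV subG Gv.
exists ((k^-1 * v^-1 * k) * v)%g; split.
- by apply: subgroupM => //; exact: subgroupJ.
- move=> e; apply: ku; rewrite -[LHS]monoid.mulg1 -e !monoid.mulgA.
  by rewrite monoid.mulgK monoid.mulgV monoid.mul1g.
- apply: compactly_supportedM => //; apply: compactly_supportedJ; first exact: GP.
  exact: compactly_supportedV.
- have -> : ((k^-1 * v^-1 * k) * v = k^-1 * (v^-1 * k * v))%g by rewrite !monoid.mulgA.
  rewrite nuM ?nuV ?nuJ //; last exact: subgroupJ.
  apply: compactly_supportedM; first exact: compactly_supportedV.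
  by apply: compactly_supportedJ => //; exact: nuP.
Qed.

(** The common fixed points, for the action of [H], of the subgroup of [G] that
    fixes the half-line up to [x]. *)
Definition right_fixed x : set R :=
  [set y | forall f, G f -> (forall z, z <= x -> f z = z) -> nu f y = y].

Lemma right_fixed_subset x y : x <= y -> right_fixed x `<=` right_fixed y.
Proof.
move=> xy w Aw f Gf f_id; apply: Aw => // z zx.
by apply: f_id; exact: le_trans xy.
Qed.

Lemma right_fixed_mem f x y : G f -> right_fixed x y ->
  right_fixed (f x) (nu f y).
Proof.
move=> Gf Ay g Gg g_id.
have GfV := subgroupV subG Gf.
have := Ay (f * g * f^-1)%g.
rewrite nuM ?nuM ?nuV //; last exact: subgroupM.
rewrite !homeo_mulE homeo_invE => fix_y.
apply: (can_inj (homeo_invK (nu f))); rewrite homeo_funK fix_y //.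
  by apply: subgroupM => //; exact: subgroupM.
move=> z zx; rewrite !homeo_mulE homeo_invE g_id ?homeo_funK //.
by rewrite Homeo_plus_le //; exact: GP.
Qed.

Lemma right_fixed_equivariant f x : G f ->
  right_fixed (f x) = nu f @` right_fixed x.
Proof.
move=> Gf; apply/seteqP; split=> [y /(right_fixed_mem (subgroupV subG Gf))|].
  rewrite homeo_invE homeo_funK nuV // homeo_invE => Ay.
  by exists (homeo_inv (nu f) y) => //; rewrite homeo_invK.
by move=> _ [y Ay <-]; exact: right_fixed_mem.
Qed.

(** Elements fixing everything below [b] have support disjoint from that of
    [c], hence commute with it; so their images fix the top of the support
    of [nu c]. *)
Lemma right_fixed_support_top c b : G c -> c <> 1%g ->
  (forall z, b <= z -> c z = z) -> compactly_supported (nu c) ->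
  right_fixed b (support_top (nu c)).
Proof.
move=> Gc c1 c_id ncc f Gf f_id.
apply: commute_fix_support_top => //; [exact: nuP|exact: nu_neq1|].
rewrite -!nuM //; congr nu.
exact: separated_supports_commute (GP Gf) (GP Gc) f_id c_id.
Qed.

Lemma right_fixed_nonempty c x : G c -> c <> 1%g ->
  compactly_supported c -> compactly_supported (nu c) -> right_fixed x !=set0.
Proof.
move=> Gc c1 /compactly_supported_fix_right[b c_id] ncc.
have x1 : x - 1 < x by rewrite ltrBlDr ltrDl.
have [f Gf /andP[_ /ltW fx]] := minimal_orbit_lt b minG x1.
exists (nu f (support_top (nu c))); apply: (right_fixed_subset fx).
exact: right_fixed_mem (right_fixed_support_top Gc c1 c_id ncc).
Qed.

(** Suppose that [nu g] has fixed points on both sides of the top [t] of the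
    support of [nu c].  The conjugates [cn n] of [c] by the powers of [g] drift
    to [+oo] on the side of [G], while on the side of [H] the tops of their
    supports are the [nu g]-orbit of [t], trapped between two fixed points and
    so convergent to some [l].  Every compactly supported [d] in [G] eventually
    commutes with [cn n], so [nu d] fixes [l].  Applied to all conjugates of [c],
    this makes [nu c] fix the whole orbit of [l], against minimality of [H]. *)
Lemma right_fixed_bounded c g a r s :
  G c -> c <> 1%g -> compactly_supported c -> compactly_supported (nu c) ->
  (forall z, z <= a -> c z = z) -> r < a ->
  G g -> (forall z, z <= s -> g z = z) -> increasing_on `]r, +oo[ g ->
  has_ubound (right_fixed s) \/ has_lbound (right_fixed s).
Proof.
move=> Gc c1 cc ncc c_id ra Gg g_id g_inc; apply: contrapT => /not_orP[nub nlb].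
pose t := support_top (nu c).
have [x [Ax xt]] : exists x, right_fixed s x /\ x < t.
  apply: contrapT => /forallNP nx; apply: nlb; exists t => x Ax.
  by rewrite leNgt; apply/negP => xt; exact: (nx x).
have [y [Ay ty]] : exists y, right_fixed s y /\ t < y.
  apply: contrapT => /forallNP ny; apply: nub; exists t => y Ay.
  by rewrite leNgt; apply/negP => ty; exact: (ny y).
have : cvgn (fun n => iter n (nu g) t).
  apply: (@iter_bounded_cvgn _ _ x _ y); [exact: nuP|exact: Ax|exact: Ay|].
  by rewrite !ltW.
set l := limn _ => t_cvg.
pose cn n := iter n (fun k => g^-1 * k * g)%g c.
have cnP n : [/\ G (cn n), cn n <> 1%g, compactly_supported (nu (cn n)),
    support_top (nu (cn n)) = iter n (nu g) t
    & forall z, z <= iter n g a -> cn n z = z].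
  elim: n => [|n [Gk k1 nck topk k_id]]; first by split.
  rewrite /cn !iterS -/(cn n); split.
  - exact: subgroupJ.
  - exact: conj_neq1.
  - by rewrite nuJ //; apply: compactly_supportedJ => //; exact: nuP.
  - by rewrite nuJ // support_top_conj ?topk //; [exact: nuP|exact: nu_neq1].
  - exact: conj_fix_left (GP Gg) k_id.
have fix_l d : G d -> compactly_supported d -> nu d l = l.
  move=> Gd /compactly_supported_fix_right[q d_id].
  apply: cvgn_fixed t_cvg _.
  near=> n.
  have [Gk k1 nck <- k_id] := cnP n.
  apply: commute_fix_support_top => //; [exact: nuP|exact: nu_neq1|].
  rewrite -!nuM //; congr nu; apply/esym.
  apply: separated_supports_commute (GP Gk) (GP Gd) _ d_id => z zq.
  apply/k_id/(le_trans zq); near: n.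
  exact: iter_increasing_unbounded (GP Gg) g_inc ra _.
apply: (nu_neq1 Gc c1); apply: (dense_orbit_fix (minH l)) => _ /nu_surj[q Gq <-].
have GqV := subgroupV subG Gq.
have /fix_l := subgroupJ subG Gc GqV.
rewrite nuJ // nuV // => fix_q.
apply: (can_inj (homeo_invK (nu q))); rewrite homeo_funK.
apply: fix_q; apply: compactly_supportedJ => //; exact: GP.
Unshelve. all: by end_near. Qed.

(** The sets [right_fixed x] grow with [x] and are permuted equivariantly, so
    their suprema form a monotone equivariant map; boundedness at a single [s]
    spreads to all [x] because the orbit of [s] is unbounded. *)
Lemma reconstruct_from_sup s : (forall x, right_fixed x !=set0) ->
  has_ubound (right_fixed s) ->
  exists u : homeo R, forall f x, G f -> u (f x) = nu f (u x).
Proof.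
move=> A0 [b bs].
have bA x : has_ubound (right_fixed x).
  have [f Gf /ltW xfs] := minimal_orbit_gt s x minG.
  exists (nu f b) => y /(right_fixed_subset xfs).
  rewrite right_fixed_equivariant // => -[z /bs zb <-].
  by rewrite Homeo_plus_le //; exact: nuP.
pose phi x := sup (right_fixed x).
have phi_eq f x : G f -> phi (f x) = nu f (phi x).
  by move=> Gf; rewrite /phi right_fixed_equivariant // sup_homeo //; exact: nuP.
have phi_le x y : x <= y -> phi x <= phi y.
  move=> xy; apply: ge_sup => // z /(right_fixed_subset xy).
  exact: ub_le_sup.
have phi_inj : injective phi.
  apply: equivariant_convex_fibers_inj phi_eq _ => x y z /andP[xy yz] xz.
  by apply/eqP; rewrite eq_le {1}xz !phi_le.
have [|u u_phi] := increasing_dense_homeo (phi := phi) _ (equivariant_range_dense phi_eq).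
  move=> x y xy; rewrite lt_neqAle phi_le ?ltW // andbT.
  by apply: contraTneq xy => /phi_inj ->; rewrite ltxx.
by exists u => f x Gf; rewrite !u_phi phi_eq.
Qed.

(** With infima the map is order-reversing; the lemma on increasing maps is
    applied to its opposite. *)
Lemma reconstruct_from_inf s : (forall x, right_fixed x !=set0) ->
  has_lbound (right_fixed s) ->
  exists u : homeo R, forall f x, G f -> u (f x) = nu f (u x).
Proof.
move=> A0 [b bs].
have bA x : has_lbound (right_fixed x).
  have [f Gf /ltW xfs] := minimal_orbit_gt s x minG.
  exists (nu f b) => y /(right_fixed_subset xfs).
  rewrite right_fixed_equivariant // => -[z /bs zb <-].
  by rewrite Homeo_plus_le //; exact: nuP.
pose phi x := inf (right_fixed x).
have phi_eq f x : G f -> phi (f x) = nu f (phi x).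
  by move=> Gf; rewrite /phi right_fixed_equivariant // inf_homeo //; exact: nuP.
have phi_ge x y : x <= y -> phi y <= phi x.
  move=> xy; apply: lb_le_inf => // z /(right_fixed_subset xy).
  exact: ge_inf.
have phi_inj : injective phi.
  apply: equivariant_convex_fibers_inj phi_eq _ => x y z /andP[xy yz] xz.
  by apply/eqP; rewrite eq_le {2}xz !phi_ge.
have [||u u_phi] := @increasing_dense_homeo _ (fun x => - phi x).
- move=> x y xy; rewrite ltrN2 lt_neqAle phi_ge ?ltW // andbT.
  by apply: contraTneq xy => /phi_inj ->; rewrite ltxx.
- move=> x y; rewrite -ltrN2 => /(equivariant_range_dense phi_eq)[t /andP[yt tx]].
  by exists t; rewrite ltrNr tx ltrNl.
have oppC : continuous (-%R : R -> R) by move=> x; exact: opp_continuous.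
exists (u * Homeo (@opprK R) (@opprK R) oppC oppC)%g => f x Gf.
by rewrite !homeo_mulE /= !u_phi !opprK phi_eq.
Qed.

End Reconstruction.

Theorem theorem1p3 (R : realType) (G H : set (homeo R)) :
  group_action G -> group_action H ->
  minimal_action G -> minimal_action H ->
  (exists f : homeo R, [/\ G f, f <> 1%g & compactly_supported f]) ->
  (exists f : homeo R, [/\ H f, f <> 1%g & compactly_supported f]) ->
  (exists g h : homeo R,
     [/\ G g, H h, trivial_germ_ninfty g, trivial_germ_ninfty h
       & exists r : R,
           increasing_on `]r, +oo[ g /\ increasing_on `]r, +oo[ h]) ->
  isomorphic G H ->
  forall nu : homeo R -> homeo R, is_isomorphism G H nu ->
  exists phi : homeo R,
    forall f : homeo R, G f -> nu f = (phi^-1 * f * phi)%g.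
Proof.
move=> aG aH mG mH [f [Gf f1 cf]] [h [Hh h1 ch]].
move=> [g [_ [Gg _ [s g_id] _ [r [g_inc _]]]]] _ nu nu_iso.
suff [u u_eq] : exists u : homeo R, forall k x, G k -> u (k x) = nu k (u x).
  exists u => k Gk; apply: homeo_ext => y.
  by rewrite -{1}(homeo_invK u y) -u_eq.
have [c [Gc c1 cc ncc]] :=
  exists_common_compact aG aH mG nu_iso Gf f1 cf Hh h1 ch.
have A0 x := right_fixed_nonempty aG aH mG nu_iso x Gc c1 cc ncc.
have [a c_id] := compactly_supported_fix_left cc.
(* A conjugate of [c] has its support in the region where [g] is increasing. *)
have [w Gw rwa] := minimal_orbit_gt a r mG.
have wP : Homeo_plus R w := proj2 aG w Gw.
pose cw := (w^-1 * c * w)%g.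
have Gcw : G cw := subgroupJ (proj1 aG) Gc Gw.
have ccw : compactly_supported cw by exact: compactly_supportedJ.
have nccw : compactly_supported (nu cw).
  exact: (compactly_supportedJ_iso aG aH nu_iso).
have g_id' z : z <= s - 1 -> g z = z.
  move=> zs; apply: g_id; rewrite in_itv /=.
  by apply: le_lt_trans zs _; rewrite ltrBlDr ltrDl.
have [] := right_fixed_bounded aG aH mH nu_iso Gcw (conj_neq1 c1) ccw nccw
  (conj_fix_left wP c_id) rwa Gg g_id' g_inc.
- exact: (reconstruct_from_sup aG aH mG mH nu_iso A0).
- exact: (reconstruct_from_inf aG aH mG mH nu_iso A0).
Qed.
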